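(* Let $G$ be a completely metrizable topological group, let $d$ be a left-invariant compatible metric on $G$, and let $T\colon G\to G$ be a continuous endomorphism of $G$. Then $T$ is either mean equicontinuous or mean sensitive (with respect to $d$).
   Context: A topological group is completely metrizable if its topology is induced by some complete metric. A compatible metric $d$ on $G$ is a metric inducing the topology of $G$ (not required to be complete); it is left-invariant if $d(zx,zy)=d(x,y)$ for all $x,y,z\in G$. A continuous endomorphism is a continuous group homomorphism $G\to G$. $T$ is mean equicontinuous if for any $\varepsilon>0$ there exists $\delta>0$ such that, for any $x,y\in G$ with $d(x,y)<\delta$, $\limsup_{n\to\infty}\frac1n\sum_{i=1}^n d(T^ix,T^iy)<\varepsilon$. $T$ is mean sensitive if there exists $\delta>0$ such that, for every $x\in G$ and $\varepsilon>0$, there exists $y\in G$ with $d(x,y)<\varepsilon$ and $\limsup_{n\to\infty}\frac1n\sum_{i=1}^n d(T^ix,T^iy)\ge\delta$. *)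

(* Defs.v *)
From HB Require Import structures.
From mathcomp Require Import all_boot all_order all_algebra.
From mathcomp Require Import all_classical all_reals all_analysis.

Set Implicit Arguments.
Unset Strict Implicit.
Unset Printing Implicit Defensive.

Import Order.TTheory GRing.Theory Num.Theory.

Local Open Scope classical_set_scope.
Local Open Scope ring_scope.

HB.mixin Record Group_Topological_isTopologicalGroup G
    & Group G & Topological G := {
  mulg_continuous : continuous (fun xy : G * G => (xy.1 * xy.2)%g) ;
  invg_continuous : continuous (fun x : G => (x^-1)%g) }.

#[short(type="topologicalGroupType")]
HB.structure Definition TopologicalGroup :=
  {G of Group G & Topological G & Group_Topological_isTopologicalGroup G}.

(* The library's metricType carries a single distance.  Here several metrics
   live on one given topological space, so a metric is a plain function. *)
Section metrics.
Context {R : realType}.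

Record is_metric (T : Type) (d : T -> T -> R) : Prop := IsMetric {
  metric_ge0 : forall x y, 0 <= d x y ;
  metric_eq0 : forall x y, d x y = 0 <-> x = y ;
  metric_symm : forall x y, d x y = d y x ;
  metric_tri : forall x y z, d x z <= d x y + d y z }.

Definition compatible_metric (T : topologicalType) (d : T -> T -> R) : Prop :=
  is_metric d /\
  forall x : T, nbhs x = nbhs_ball_ (fun y e => [set z | d y z < e]) x.

Definition cauchy_seq (T : Type) (d : T -> T -> R) (u : nat -> T) : Prop :=
  forall e, 0 < e ->
    exists N, forall m n, (N <= m)%N -> (N <= n)%N -> d (u m) (u n) < e.

Definition complete_metric (T : Type) (d : T -> T -> R) : Prop :=
  is_metric d /\
  forall u, cauchy_seq d u -> exists l, (fun n => d (u n) l) @ \oo --> 0.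

Definition completely_metrizable (T : topologicalType) : Prop :=
  exists d : T -> T -> R, compatible_metric d /\ complete_metric d.

Definition left_invariant (G : groupType) (d : G -> G -> R) : Prop :=
  forall x y z : G, d (z * x)%g (z * y)%g = d x y.

Definition mean_dist (X : Type) (d : X -> X -> R) (T : X -> X) (x y : X)
    (n : nat) : R :=
  n%:R^-1 * \sum_(1 <= i < n.+1) d (iter i T x) (iter i T y).

(* The upper limit is taken in the extended reals since d may be unbounded. *)
Definition limsup_mean_dist (X : Type) (d : X -> X -> R) (T : X -> X)
    (x y : X) : \bar R :=
  limn_esup (fun n => (mean_dist d T x y n)%:E).

Definition mean_equicontinuous (X : Type) (d : X -> X -> R) (T : X -> X) :=
  forall e : R, 0 < e ->
    exists2 delta : R, 0 < delta &
      forall x y, d x y < delta -> (limsup_mean_dist d T x y < e%:E)%E.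

Definition mean_sensitive (X : Type) (d : X -> X -> R) (T : X -> X) :=
  exists2 delta : R, 0 < delta &
    forall (x : X) (e : R), 0 < e ->
      exists2 y, d x y < e & (delta%:E <= limsup_mean_dist d T x y)%E.

End metrics.

Arguments completely_metrizable R T : clear implicits.

(* Main.v *)
Require Import Defs.
From mathcomp Require Import all_boot all_order all_algebra.
From mathcomp Require Import all_classical all_reals all_analysis.

Import Order.TTheory.

Local Open Scope classical_set_scope.
Local Open Scope ring_scope.

(** The dichotomy rests on homogeneity.  The iterates of an endomorphism [T]
are homomorphisms, so a left translation of a pair of points translates the
pair of orbits term by term, and a left-invariant [d] does not see it: the
distance [d] and the upper mean distance along orbits are both invariant under
left translation ([mean_dist_mulg]).  The quantifier over base points, which
separates mean equicontinuity from mean sensitivity, is therefore harmless: if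
mean equicontinuity fails for some [e], there are arbitrarily close pairs
[x, y] whose upper mean distance is at least [e], and translating such a pair
by [w x^-1] moves its first point to any prescribed [w].  Thus [T] is mean
sensitive with constant [e].  Conversely, a sensitivity constant taken as [e]
contradicts mean equicontinuity at any base point. *)

Lemma iter_mulg (G : groupType) (T : {multiplicative G -> G}) (n : nat)
    (x y : G) :
  iter n T (x * y)%g = (iter n T x * iter n T y)%g.
Proof. by elim: n => //= n ->; rewrite gmulfM. Qed.

Lemma mean_dist_mulg (R : realType) (G : groupType) (d : G -> G -> R)
    (hdl : left_invariant d) (T : {multiplicative G -> G}) (z x y : G) :
  mean_dist d T (z * x)%g (z * y)%g = mean_dist d T x y.
Proof.
apply/funext => n; rewrite /mean_dist; congr (_ * _).
by apply: eq_bigr => i _; rewrite !iter_mulg hdl.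
Qed.

(** The failure of mean equicontinuity at one pair of points at each scale is
enough: translations carry that pair to every base point. *)
Lemma mean_equicontinuous_or_sensitive (R : realType) (G : groupType)
    (d : G -> G -> R) (hdl : left_invariant d)
    (T : {multiplicative G -> G}) :
  mean_equicontinuous d T \/ mean_sensitive d T.
Proof.
have [|Neq] := pselect (mean_equicontinuous d T); [by left|right].
apply: contrapT => Nsens; apply: Neq => e e0.
apply: contrapT => Ndelta; apply: Nsens; exists e => // w r r0.
apply: contrapT => Ny; apply: Ndelta; exists r => // x y dxy.
rewrite ltNge; apply/negP => le_e; apply: Ny.
(* the translate of the pair (x, y) whose first point is w *)
have wE : (w * x^-1 * x)%g = w by rewrite mulgVK.
exists (w * x^-1 * y)%g.
  by rewrite -{1}wE hdl.
by rewrite -{1}wE /limsup_mean_dist (mean_dist_mulg _ _ _ hdl).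
Qed.

(** The point [x] is there because both properties hold on the empty space. *)
Lemma mean_equicontinuous_not_sensitive (R : realType) (X : Type)
    (d : X -> X -> R) (T : X -> X) (x : X) :
  mean_equicontinuous d T -> ~ mean_sensitive d T.
Proof.
move=> equi [e e0 sens]; have [r r0 close] := equi e e0.
have [y dxy le_e] := sens x r r0.
by have := close x y dxy; rewrite ltNge le_e.
Qed.

Theorem theorem4p9 (R : realType) (G : topologicalGroupType)
    (hG : completely_metrizable R G)
    (d : G -> G -> R) (hd : compatible_metric d) (hdl : left_invariant d)
    (T : {multiplicative G -> G}) (hT : continuous T) :
  (mean_equicontinuous d T \/ mean_sensitive d T) /\
  ~ (mean_equicontinuous d T /\ mean_sensitive d T).
Proof.
split; first exact: mean_equicontinuous_or_sensitive.
by move=> [equi]; apply: (mean_equicontinuous_not_sensitive _ _ _ _ (1%g : G)).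
Qed.
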